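(* Let $\Gamma$ be a Coxeter graph and let $\Gamma'$ be a subgraph of $\Gamma$. Let $(W,S)$ and $(W',S')$ be the Coxeter systems associated to $\Gamma$ and $\Gamma'$ respectively, so that $S'\subset S$. Fix a total order on $S'$; this induces a lexicographic order on $(S')^{*}$. For any element $w\in W'$, let $\mathbf{w}^{\min}\in (S')^{*}$ be the lexicographically minimal reduced word (in $(W',S')$) that represents $w$. Regarding $\mathbf{w}^{\min}$ as an element of $S^{*}$ and composing with the natural product map $S^{*}\to W$, the function $W'\to S^{*}$, $w\mapsto \mathbf{w}^{\min}$, induces a (set-theoretic) injection $W'\to W$. In particular, if $W'$ is infinite, then so is $W$.
   Context: A Coxeter system $(W,S)$ consists of a group $W$ and a finite generating set $S$, determined by a symmetric function $m\colon S\times S\to\{1,2,3,\ldots\}\cup\{\infty\}$ with $m(s,s')=1$ if and only if $s=s'$; $W$ is the group generated by $S$ with defining relations $(ss')^{m(s,s')}=1$ for all $s,s'\in S$ with $m(s,s')\neq\infty$. The associated Coxeter graph has vertex set $S$, an edge between distinct $s,s'$ whenever $m(s,s')\ge 3$ (an unlabelled edge means $m=3$, a label gives the value $m(s,s')\ge4$, no edge means $m=2$); conversely a Coxeter graph determines its Coxeter system. A subgraph $\Gamma'$ of a Coxeter graph $\Gamma$ is either $\Gamma$ itself or a graph obtained from $\Gamma$ by doing one or both of: omitting one or more vertices together with all edges adjacent to them; decreasing the labels on one or more edges. (In terms of the functions $m',m$: $S'\subset S$ and $2\le m'(s,t)\le m(s,t)$ for all distinct $s,t\in S'$, with $\infty$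 the largest value and label $2$ meaning no edge.) $S^{*}$ is the free monoid on $S$; its elements are words, and a word represents the element of $W$ that is the product of its letters. $|\mathbf{w}|$ is the number of letters of $\mathbf{w}$. The length $\ell(w)$ of $w \in W$ is the minimum of $|\mathbf{w}|$ over words $\mathbf{w}$ representing $w$, and $\mathbf{w}$ representing $w$ is reduced if $|\mathbf{w}|=\ell(w)$. *)

(* Defs.v *)
From HB Require Import structures.
From mathcomp Require Import all_boot all_order.
From mathcomp Require Import boolp classical_sets functions cardinality.

Set Implicit Arguments.
Unset Strict Implicit.
Unset Printing Implicit Defensive.

Local Open Scope group_scope.

(* A group word on [S] is a sequence of signed letters: [(s, false)] stands for
   the generator [s] and [(s, true)] for its formal inverse. *)
Definition group_word (S : Type) := seq (S * bool).

Section Presentation.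
Variable S : choiceType.
Implicit Types (R : group_word S -> Prop) (a b c u v r : group_word S).

(* Equality in the group < S | r = 1 for all r satisfying R >. *)
Inductive presentation_eq R : group_word S -> group_word S -> Prop :=
| PresRefl u : presentation_eq R u u
| PresSym u v : presentation_eq R u v -> presentation_eq R v u
| PresTrans u v w : presentation_eq R u v -> presentation_eq R v w ->
    presentation_eq R u w
| PresCancel u v s e :
    presentation_eq R (u ++ [:: (s, e); (s, ~~ e)] ++ v) (u ++ v)
| PresRelator u v r : R r -> presentation_eq R (u ++ r ++ v) (u ++ v).

Definition presentation_eqb R : rel (group_word S) :=
  fun u v => `[< presentation_eq R u v >].

Lemma presentation_eqb_refl R : reflexive (presentation_eqb R).
Proof. by move=> u; apply/asboolP; apply: PresRefl. Qed.

Lemma presentation_eqb_sym R : symmetric (presentation_eqb R).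
Proof. by move=> u v; apply/asboolP/asboolP; apply: PresSym. Qed.

Lemma presentation_eqb_trans R : transitive (presentation_eqb R).
Proof.
move=> v u w /asboolP uv /asboolP vw.
by apply/asboolP; apply: PresTrans uv vw.
Qed.

Canonical presentation_equiv R :=
  EquivRel (presentation_eqb R) (presentation_eqb_refl R)
    (presentation_eqb_sym R) (@presentation_eqb_trans R).

Definition presented_group R : Type :=
  {eq_quot (presentation_equiv R)}%qT.

HB.instance Definition _ R := Choice.on (presented_group R).
HB.instance Definition _ R := EqQuotient.on (presented_group R).

Local Open Scope quotient_scope.

Definition word_inv u : group_word S := rev [seq (x.1, ~~ x.2) | x <- u].

Lemma presentation_eq_catl R c u v :
  presentation_eq R u v -> presentation_eq R (c ++ u) (c ++ v).
Proof.
elim=> {u v} [u|u v _ IH|u v w _ IH1 _ IH2|u v s e|u v r Rr].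
- exact: PresRefl.
- exact: PresSym.
- exact: PresTrans IH1 IH2.
- by rewrite !(catA c u); apply: PresCancel.
- by rewrite !(catA c u); apply: PresRelator.
Qed.

Lemma presentation_eq_catr R c u v :
  presentation_eq R u v -> presentation_eq R (u ++ c) (v ++ c).
Proof.
elim=> {u v} [u|u v _ IH|u v w _ IH1 _ IH2|u v s e|u v r Rr].
- exact: PresRefl.
- exact: PresSym.
- exact: PresTrans IH1 IH2.
- by rewrite -!catA; apply: PresCancel.
- by rewrite -!catA; apply: PresRelator.
Qed.

Lemma word_invK : involutive word_inv.
Proof.
move=> u; rewrite /word_inv map_rev revK -map_comp map_id_in //.
by case=> s e _ /=; rewrite negbK.
Qed.

Lemma presentation_eq_mulwV R u : presentation_eq R (u ++ word_inv u) [::].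
Proof.
elim: u => [|[s e] u IH]; first exact: PresRefl.
rewrite /word_inv /= rev_cons -cats1 -/(word_inv u).
apply: PresTrans (PresCancel R [::] [::] s e) => /=.
rewrite catA -(cat1s _ (_ ++ _)).
rewrite -[X in presentation_eq R _ X]/([:: (s, e)] ++ [:: (s, ~~ e)]).
apply: presentation_eq_catl.
by rewrite -[X in presentation_eq R _ X]/([::] ++ [:: (s, ~~ e)]);
  apply: presentation_eq_catr.
Qed.

Lemma presentation_eq_mulVw R u : presentation_eq R (word_inv u ++ u) [::].
Proof. by rewrite -{2}(word_invK u); apply: presentation_eq_mulwV. Qed.

Lemma presentation_pi R u v :
  \pi_(presented_group R) u = \pi_(presented_group R) v <->
  presentation_eq R u v.
Proof.
split=> [/eqP|uv]; first by rewrite eqmodE => /asboolP.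
by apply/eqP; rewrite eqmodE; apply/asboolP.
Qed.

Lemma presentation_repr R u :
  presentation_eq R (repr (\pi_(presented_group R) u)) u.
Proof. by apply/presentation_pi; rewrite reprK. Qed.

Definition presented_one R : presented_group R :=
  \pi_(presented_group R) [::].
Definition presented_mul R (x y : presented_group R) : presented_group R :=
  \pi_(presented_group R) (repr x ++ repr y).
Definition presented_inv R (x : presented_group R) : presented_group R :=
  \pi_(presented_group R) (word_inv (repr x)).

Lemma presented_mulE R u v :
  presented_mul (\pi_(presented_group R) u) (\pi_(presented_group R) v) =
  \pi_(presented_group R) (u ++ v).
Proof.
apply/presentation_pi.
apply: (@PresTrans _ _ (u ++ repr (\pi_(presented_group R) v))).
  exact/presentation_eq_catr/presentation_repr.
exact/presentation_eq_catl/presentation_repr.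
Qed.

Lemma presented_mulA R : associative (@presented_mul R).
Proof.
move=> x y z; elim/quotW: x => x; elim/quotW: y => y; elim/quotW: z => z.
by rewrite (presented_mulE R y z) (presented_mulE R x y) !presented_mulE catA.
Qed.

Lemma presented_mul1 R : left_id (presented_one R) (@presented_mul R).
Proof. by move=> x; rewrite -[x]reprK presented_mulE. Qed.

Lemma presented_mulr1 R : right_id (presented_one R) (@presented_mul R).
Proof. by move=> x; rewrite -[x]reprK presented_mulE cats0. Qed.

Lemma presented_mulV R :
  left_inverse (presented_one R) (@presented_inv R) (@presented_mul R).
Proof.
move=> x; rewrite -{2}[x]reprK presented_mulE.
exact/presentation_pi/presentation_eq_mulVw.
Qed.

Lemma presented_mulrV R :
  right_inverse (presented_one R) (@presented_inv R) (@presented_mul R).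
Proof.
move=> x; rewrite -{1}[x]reprK presented_mulE.
exact/presentation_pi/presentation_eq_mulwV.
Qed.

HB.instance Definition _ R := isGroup.Build (presented_group R)
  (@presented_mulA R) (@presented_mul1 R) (@presented_mulr1 R)
  (@presented_mulV R) (@presented_mulrV R).

Definition presented_gen R (s : S) : presented_group R :=
  \pi_(presented_group R) [:: (s, false)].

Lemma presented_piM R u v :
  \pi_(presented_group R) (u ++ v) =
  \pi_(presented_group R) u * \pi_(presented_group R) v.
Proof. by rewrite -presented_mulE. Qed.

Lemma presented_piE R u :
  \pi_(presented_group R) u =
  \prod_(x <- u) (if x.2 then (presented_gen R x.1)^-1 else presented_gen R x.1).
Proof.
elim: u => [|[s e] u IH]; first by rewrite big_nil.
rewrite big_cons -IH -cat1s presented_piM; congr (_ * _).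
case: e => //=; apply/eqP; rewrite -(inj_eq (mulgI (presented_gen R s))) mulgV.
rewrite -presented_piM; apply/eqP/presentation_pi.
exact: (PresCancel R [::] [::] s false).
Qed.

Lemma presented_relator R u : R u -> \pi_(presented_group R) u = 1.
Proof.
move=> Ru; apply/presentation_pi; rewrite -[u]cats0.
exact: (PresRelator [::] [::] Ru).
Qed.

Lemma presented_lift R (H : groupType) (f : S -> H) :
  (forall r, R r -> \prod_(x <- r) (if x.2 then (f x.1)^-1 else f x.1) = 1) ->
  exists2 phi : presented_group R -> H,
    {morph phi : x y / x * y} & forall s, phi (presented_gen R s) = f s.
Proof.
move=> fR; pose F u := \prod_(x <- u) (if x.2 then (f x.1)^-1 else f x.1).
have FM u v : F (u ++ v) = F u * F v by rewrite /F big_cat.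
have Feq u v : presentation_eq R u v -> F u = F v.
  elim=> {u v} // [u v w _ -> _ -> //|u v s e|u v r Rr].
    rewrite !FM; congr (_ * _); rewrite -[RHS]mul1g; congr (_ * _).
    by rewrite /F big_cons big_seq1; case: e; rewrite /= ?mulVg ?mulgV.
  by rewrite !FM [F r]fR // mul1g.
exists (fun x => F (repr x)) => [x y|s] /=.
  by rewrite -FM; apply: Feq; apply: presentation_repr.
rewrite (Feq _ [:: (s, false)]); first by rewrite /F big_seq1.
exact: presentation_repr.
Qed.

End Presentation.

(* [None] stands for infinity. *)
Definition coxeter_label := option nat.

Definition label_le (a b : coxeter_label) : bool :=
  match a, b with
  | _, None => true
  | None, Some _ => false
  | Some p, Some q => (p <= q)%N
  end.

Record coxeter_graph (S : finType) := CoxeterGraph {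
  coxeter_m :> S -> S -> coxeter_label;
  coxeter_m_sym : forall s t, coxeter_m s t = coxeter_m t s;
  coxeter_m_gt0 : forall s t, coxeter_m s t != Some 0%N;
  coxeter_m_eq1 : forall s t, coxeter_m s t = Some 1%N <-> s = t
}.

(* [G'] has vertex set [S']; off the diagonal its labels, which are at least 2,
   do not exceed those of [G]. *)
Definition coxeter_subgraph (S : finType) (G : coxeter_graph S)
    (S' : {set S}) (G' : coxeter_graph {x : S | x \in S'}) : Prop :=
  forall s t : {x : S | x \in S'}, s != t ->
    label_le (G' s t) (G (val s) (val t)).

Section CoxeterGroup.
Variables (S : finType) (G : coxeter_graph S).
Implicit Types (u v : seq S).

Definition coxeter_relator (r : group_word S) : Prop :=
  exists s t n, G s t = Some n /\
    r = flatten (nseq n [:: (s, false); (t, false)]).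

Definition coxeter_group : Type := presented_group coxeter_relator.

HB.instance Definition _ := Group.on coxeter_group.

Definition coxeter_gen (s : S) : coxeter_group :=
  presented_gen coxeter_relator s.

Definition word_prod u : coxeter_group := \prod_(s <- u) coxeter_gen s.

Lemma coxeter_genK (s : S) : coxeter_gen s * coxeter_gen s = 1.
Proof.
rewrite /coxeter_gen -[LHS]presented_piM /=.
apply: presented_relator; exists s, s, 1%N; split=> //.
exact/coxeter_m_eq1.
Qed.

Lemma word_exists (w : coxeter_group) :
  exists n, [exists u : n.-tuple S, word_prod u == w].
Proof.
pose g := repr w; exists (size [seq x.1 | x <- g]).
apply/existsP; exists (in_tuple [seq x.1 | x <- g]); apply/eqP => /=.
rewrite -[w]reprK -/g [RHS]presented_piE /word_prod big_map.
apply: eq_bigr => -[s []] _ //=.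
by apply: (mulgI (coxeter_gen s)); rewrite coxeter_genK mulgV.
Qed.

Definition coxeter_length (w : coxeter_group) : nat := ex_minn (word_exists w).

Definition reduced_word u : bool := size u == coxeter_length (word_prod u).

Lemma coxeter_length_le u : (coxeter_length (word_prod u) <= size u)%N.
Proof.
rewrite /coxeter_length; case: ex_minnP => n _; apply.
by apply/existsP; exists (in_tuple u).
Qed.

Lemma reduced_word_exists (w : coxeter_group) :
  exists u : (coxeter_length w).-tuple S, word_prod u = w.
Proof.
by rewrite /coxeter_length; case: ex_minnP => n /existsP[u /eqP uw] _; exists u.
Qed.

End CoxeterGroup.

Record total_order (T : Type) (le : rel T) : Prop := TotalOrder {
  total_order_refl : reflexive le;
  total_order_anti : antisymmetric le;
  total_order_trans : transitive le;
  total_order_total : total le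
}.

(* The order of [seqlexi] for an order relation given explicitly, since a
   subset of [S] carries no canonical order; see [lexi_seqlexi]. *)
Fixpoint lexi (T : Type) (le : rel T) (u v : seq T) : bool :=
  match u, v with
  | [::], _ => true
  | _ :: _, [::] => false
  | x :: u', y :: v' => le x y && (le y x ==> lexi le u' v')
  end.

Lemma lexi_seqlexi d (T : orderType d) (u v : seq T) :
  lexi (fun x y : T => (x <= y)%O) u v =
  ((u : Order.SeqLexiOrder.Exports.seqlexi T) <= v)%O.
Proof.
elim: u v => [|x u IH] [|y v]; rewrite ?Order.SeqLexiOrder.Exports.lexi0s //.
by rewrite Order.SeqLexiOrder.Exports.lexi_cons /= IH.
Qed.

Lemma lexi_total_order (T : Type) (le : rel T) :
  total_order le -> total_order (lexi le).
Proof.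
case=> refl anti trans tot; split.
- by elim=> //= x u ->; rewrite refl implybT.
- elim=> [|x u IH] [|y v] //= /andP[/andP[xy uv] /andP[yx vu]].
  have -> : x = y by apply: anti; rewrite xy yx.
  by congr cons; apply: IH; move: uv vu; rewrite xy yx /= => -> ->.
- move=> v u; elim: u v => [|x u IH] [|y v] [|z w] //=.
  move=> /andP[xy uv] /andP[yz vw]; rewrite (trans _ _ _ xy yz) /=.
  apply/implyP => zx; apply: (IH v).
    by apply: (implyP uv); apply: trans yz zx.
  by apply: (implyP vw); apply: trans zx xy.
- elim=> [|x u IH] [|y v] //=.
  have := tot x y; case: (le x y); case: (le y x) => //= _.
Qed.

Section MinWord.
Variables (S : finType) (G : coxeter_graph S) (le : rel S).

Definition is_min_word (w : coxeter_group G) (u : seq S) : Prop :=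
  [/\ word_prod G u = w, reduced_word G u &
      forall v, word_prod G v = w -> reduced_word G v -> lexi le u v].

(* The default value [::] is never used when [le] is a total order, see
   [min_wordP]. *)
Definition min_word (w : coxeter_group G) : seq S :=
  xget [::] [set u : seq S | is_min_word w u].

Lemma min_wordP (w : coxeter_group G) :
  total_order le -> is_min_word w (min_word w).
Proof.
move=> /lexi_total_order[refl _ trans tot]; rewrite /min_word.
suff [u wu] : exists u, is_min_word w u by case: xgetP => [u' -> //|/(_ u)].
have [u0 /eqP u0w] := reduced_word_exists w.
pose P (u : (coxeter_length w).-tuple S) := word_prod G u == w.
pose F (u : (coxeter_length w).-tuple S) := val u.
have [u /eqP uw umin] := extremumP (P := P) F refl trans tot u0w.
exists u; split=> //; first by rewrite /reduced_word uw size_tuple.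
move=> v vw; rewrite /reduced_word vw => vl.
by apply: (umin (Tuple vl)); apply/eqP.
Qed.

Lemma is_min_word_uniq (w : coxeter_group G) (u v : seq S) :
  total_order le -> is_min_word w u -> is_min_word w v -> u = v.
Proof.
move=> /lexi_total_order[_ anti _ _] [uw ur umin] [vw vr vmin].
by apply: anti; rewrite umin ?vmin.
Qed.

End MinWord.

(* Main.v *)
(* A word that is reduced in W' is reduced in W, and two words reduced in W' that
   agree in W already agree in W'.  Two facts about W are needed: the exchange
   condition, from an action of W on W x {0, 1} by conjugation and parity, and
   that s t has order exactly m(s, t), from a representation over the algebraic
   numbers.  Then one proves Matsumoto's theorem by induction on a word reduced in
   W' while never leaving W': a braid move of W of length m(s, t) > m'(s, t) cannot
   occur, because an alternating word of that length is not reduced in W'. *)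

Require Import Defs.
From mathcomp Require Import all_boot all_algebra all_field.
From mathcomp Require Import boolp classical_sets functions cardinality.
From mathcomp Require Import zify ring.

Set Implicit Arguments.
Unset Strict Implicit.
Unset Printing Implicit Defensive.

Import GRing.Theory Num.Theory.

Local Open Scope group_scope.

(** * Alternating words *)

Fixpoint alt_word (T : Type) (s t : T) (n : nat) : seq T :=
  if n is n'.+1 then s :: alt_word t s n' else [::].

Lemma size_alt_word (T : Type) (s t : T) n : size (alt_word s t n) = n.
Proof. by elim: n s t => //= n IH s t; rewrite IH. Qed.

Lemma take_alt_word (T : Type) (s t : T) i n :
  i <= n -> take i (alt_word s t n) = alt_word s t i.
Proof. by elim: n i s t => [|n IH] [|i] s t //= ?; rewrite IH. Qed.

Lemma map_alt_word (T U : Type) (f : T -> U) s t n :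
  [seq f x | x <- alt_word s t n] = alt_word (f s) (f t) n.
Proof. by elim: n s t => //= n IH s t; rewrite IH. Qed.

Lemma foldl_flatten_nseq (T X : Type) (f : X -> T -> X) s t n x :
  foldl f x (flatten (nseq n [:: s; t])) = iter n (fun y => f (f y s) t) x.
Proof. by elim: n x => // n IH x; rewrite iterSr /= IH. Qed.

(** * Words in a Coxeter group and letterwise actions *)

Section Words.
Variables (S : finType) (G : coxeter_graph S).
Implicit Types (u v b : seq S) (s t r : S).

Local Notation g := (coxeter_gen G).
Local Notation wp := (word_prod G).

Lemma word_prod_cons s u : wp (s :: u) = g s * wp u.
Proof. by rewrite /word_prod big_cons. Qed.

Lemma word_prod_cat u v : wp (u ++ v) = wp u * wp v.
Proof. by rewrite /word_prod big_cat. Qed.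

Lemma word_prod_nil : wp [::] = 1.
Proof. by rewrite /word_prod big_nil. Qed.

Lemma coxeter_genKl s (w : coxeter_group G) : g s * (g s * w) = w.
Proof. by rewrite mulgA coxeter_genK mul1g. Qed.

Lemma coxeter_genV s : (g s)^-1 = g s.
Proof. by apply: (mulgI (g s)); rewrite mulgV coxeter_genK. Qed.

Lemma word_prod_flatten s t n :
  wp (flatten (nseq n [:: s; t])) = (g s * g t) ^+ n.
Proof.
elim: n => [|n IH]; first by rewrite word_prod_nil.
by rewrite expgS -IH /= !word_prod_cons mulgA.
Qed.

Lemma word_prod_alt s t n :
  wp (alt_word s t n) = (g s * g t) ^+ n * wp (alt_word t s n).
Proof.
elim: n s t => [|n IH] s t; first by rewrite mul1g.
rewrite /= word_prod_cons [wp (alt_word t s n)]IH.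
have comm : g s * (g t * g s) ^+ n = (g s * g t) ^+ n * g s.
  elim: n {IH} => [|n IHn]; first by rewrite mulg1 mul1g.
  by rewrite !expgS mulgA -[LHS]mulgA -!mulgA IHn.
by rewrite word_prod_cons mulgA comm expgSr -!mulgA coxeter_genKl.
Qed.

Lemma word_prod_piE u :
  wp u = \pi_(coxeter_group G)%qT [seq (s, false) | s <- u].
Proof. by rewrite presented_piE big_map. Qed.

Lemma gen_mul_expg s t n : G s t = Some n -> (g s * g t) ^+ n = 1.
Proof.
move=> Gst; rewrite -word_prod_flatten word_prod_piE map_flatten map_nseq.
by apply: presented_relator; exists s, t, n.
Qed.

Lemma word_prod_braid s t n :
  G s t = Some n -> wp (alt_word s t n) = wp (alt_word t s n).
Proof. by move=> Gst; rewrite word_prod_alt gen_mul_expg // mul1g. Qed.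

(** A letterwise action that respects the relations factors through the group; letters act as
    involutions, so signs can be forgotten. *)
Lemma word_prod_foldl (X : Type) (f : X -> S -> X) u v x :
  (forall s y, f (f y s) s = y) ->
  (forall s t n y, G s t = Some n -> iter n (fun y => f (f y s) t) y = y) ->
  wp u = wp v -> foldl f x u = foldl f x v.
Proof.
move=> fK frel uv.
pose sg := map (fun s : S => (s, false)).
have sgE w : [seq y.1 | y <- sg w] = w by rewrite -map_comp map_id.
move: uv; rewrite !word_prod_piE => /presentation_pi.
rewrite -{2}(sgE u) -{2}(sgE v).
rewrite -!/(sg _); move: (sg u) (sg v) => {u v sgE sg} u v uv.
elim: uv x => {u v} [u|u v _ IH|u v w _ IH1 _ IH2|u v s e|u v r Rr] x //.
- by rewrite IH1.
- by rewrite !map_cat !foldl_cat /= fK.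
- case: Rr => s [t [n [Gst ->]]].
  rewrite !map_cat !foldl_cat map_flatten map_nseq /=.
  by rewrite foldl_flatten_nseq frel.
Qed.

Lemma reduced_wordP u :
  reflect (forall v, wp v = wp u -> size u <= size v) (reduced_word G u).
Proof.
apply: (iffP eqP) => [-> v <-|umin]; first exact: coxeter_length_le.
apply/eqP; rewrite eqn_leq coxeter_length_le andbT.
by have [v vu] := reduced_word_exists (wp u); rewrite -(size_tuple v) umin.
Qed.

(** * The exchange condition *)

(* A right action of the words on (group elements) x (parities).  Started at
   [(x, false)], the word [s_1 ... s_n] returns the parity of the number of [i]
   such that [x] is the reflection [(s_1 ... s_i) (s_1 ... s_(i-1))^-1]. *)
Definition reflect_step (y : coxeter_group G * bool) s :=
  (y.1 ^ g s, y.2 (+) (y.1 == g s)).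

Lemma conjg_eqE (x y z : coxeter_group G) : (x ^ y == z) = (x == z ^ y^-1).
Proof. by apply/eqP/eqP => [<-|->]; rewrite ?conjgK ?conjgKV. Qed.

Lemma reflect_stepK s y : reflect_step (reflect_step y s) s = y.
Proof.
case: y => x e; rewrite /reflect_step /= -conjgM coxeter_genK conjg1.
rewrite conjg_eqE coxeter_genV.
by rewrite conjgE mulKg -addbA addbb addbF.
Qed.

Lemma reflect_step_iter s t n x e :
  iter n (fun y => reflect_step (reflect_step y s) t) (x, e) =
  (x ^ ((g s * g t) ^+ n),
   e (+) \big[addb/false]_(0 <= i < n + n) (x == (g s * g t) ^+ i * g s)).
Proof.
set p := g s * g t.
have gp k : g s * p ^- k = p ^+ k * g s.
  elim: k => [|k IH]; first by rewrite invg1 mulg1 mul1g.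
  rewrite expgSr invgM mulgA {1}/p invgM !coxeter_genV.
  rewrite [g s * (g t * g s)]mulgA -/p -[p * g s * _]mulgA IH.
  by rewrite mulgA -expgS expgSr.
have gsp k : g s ^ (p ^- k) = p ^+ (k + k) * g s.
  by rewrite conjgE invgK gp mulgA -expgnDr.
elim: n => [|n IH]; first by rewrite conjg1 big_nil addbF.
rewrite iterS IH /reflect_step /= -!conjgM; congr pair.
  by rewrite -/p -expgSr.
(* The letters [s] and [t] of round [n] account for the indices [n + n] and [(n + n).+1]. *)
rewrite addSn addnS !big_nat_recr //= -!addbA; congr (_ (+) (_ (+) (_ (+) _))).
  by rewrite conjg_eqE gsp.
rewrite conjg_eqE invgM conjgM; congr (_ == _).
rewrite coxeter_genV (_ : g t ^ g s = p * g s); last first.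
  by rewrite conjgE coxeter_genV mulgA.
by rewrite conjgE invgK -mulgA gp [p * _]mulgA -expgS mulgA -expgnDr addnS.
Qed.

(** For a label [n], the reflections [(g s * g t) ^+ i * g s] have period [n] in [i], so the two
    halves of the parity sum cancel. *)
Lemma reflect_foldl u v y :
  wp u = wp v -> foldl reflect_step y u = foldl reflect_step y v.
Proof.
apply: word_prod_foldl => [s z|s t n [x e] Gst]; first exact: reflect_stepK.
rewrite reflect_step_iter (gen_mul_expg Gst) conjg1; congr pair.
rewrite (big_cat_nat (n := n)) ?leq_addr //= -{2}[n]add0n big_addn addnK.
under [X in _ (+) (_ (+) X)]eq_bigr do
  rewrite expgnDr (gen_mul_expg Gst) mulg1.
by rewrite addbb addbF.
Qed.

(** The parity flips only where the current conjugate of [x] equals the next letter; [i] is the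
    first such position. *)
Lemma reflect_foldl_neq u x e :
  (foldl reflect_step (x, e) u).2 != e ->
  exists2 i, i < size u & x * wp (take i u) = wp (take i.+1 u).
Proof.
elim: u x e => [|r u IH] x e /=; first by rewrite eqxx.
rewrite /reflect_step /=; have [-> _|xr] := eqVneq x (g r).
  by exists 0 => //; rewrite /= take0 word_prod_cons.
rewrite addbF => /IH[i iu xi]; exists i.+1 => //=.
by rewrite !word_prod_cons -xi conjgE !mulgA mulgV mul1g.
Qed.

Definition left_descent s u := (foldl reflect_step (g s, false) u).2.

Lemma left_descent_eq s u v : wp u = wp v -> left_descent s u = left_descent s v.
Proof. by rewrite /left_descent => /reflect_foldl ->. Qed.

Lemma exchange_prefix s u : left_descent s u ->
  exists2 i, i < size u & g s * wp (take i u) = wp (take i.+1 u).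
Proof.
by move=> d; apply: (@reflect_foldl_neq u (g s) false); rewrite eqbF_neg negbK.
Qed.

(** The leading [s] flips the parity, so a second flip must occur inside [u]. *)
Lemma exchange_prefix_cons s u : ~~ left_descent s (s :: u) ->
  exists2 i, i < size u & g s * wp (take i u) = wp (take i.+1 u).
Proof.
move=> d; apply: (@reflect_foldl_neq u (g s) true); rewrite eqb_id.
by move: d; rewrite /left_descent /= /reflect_step /= eqxx conjgE mulKg.
Qed.

Lemma word_prod_delete s u i : i < size u ->
  g s * wp (take i u) = wp (take i.+1 u) ->
  g s * wp u = wp (take i u ++ drop i.+1 u).
Proof.
move=> iu; rewrite -[in wp u](cat_take_drop i u) (drop_nth s iu).
rewrite (take_nth s iu) -cats1 !word_prod_cat !word_prod_cons word_prod_nil mulg1.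
by move=> si; rewrite mulgA si -mulgA coxeter_genKl.
Qed.

Lemma size_delete u i :
  i < size u -> (size (take i u ++ drop i.+1 u)).+1 = size u.
Proof.
move=> iu; rewrite size_cat size_drop size_takel 1?ltnW //; lia.
Qed.

(** Exchanging [s] into [alt_word t s k ++ b] must delete a letter of [b]: a deletion in the
    alternating part would equate two short alternating words. *)
Lemma dihedral_prefix s t v k :
  left_descent s v -> left_descent t v ->
  (forall j, 0 < j < k -> wp (alt_word s t j) <> wp (alt_word t s j)) ->
  exists2 b, wp (alt_word s t k ++ b) = wp v & size b + k = size v.
Proof.
move=> sv tv; elim: k s t sv tv => [|k IH] s t sv tv ne.
  by exists v; rewrite ?addn0.
have [|b bv sb] := IH t s tv sv.
  by move=> j /andP[j0 jk]; apply/nesym/ne; rewrite j0 ltnW.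
have sd : left_descent s (alt_word t s k ++ b) by rewrite (left_descent_eq _ bv).
have [i iu si] := exchange_prefix sd.
have [ik|ki] := ltnP i k.
  case: (ne i.+1) => //.
  move: si; rewrite !takel_cat ?size_alt_word ?(ltnW ik) //.
  by rewrite !take_alt_word ?(ltnW ik) // -word_prod_cons.
have := word_prod_delete iu si; have := size_delete iu.
rewrite take_cat size_alt_word ltnNge ki drop_cat size_alt_word ltnNge.
rewrite (leqW ki) /= -catA => sz del.
exists (take (i - k) b ++ drop (i.+1 - k) b).
  by rewrite /= word_prod_cons -del coxeter_genKl.
by move: sz; rewrite -sb !size_cat size_alt_word; lia.
Qed.

(** * The order of [s t], from the numbers game *)

Section Geometric.
Local Open Scope ring_scope.

(* For the infinite label any number that is not a root of unity would do. *)
Definition label_root (l : coxeter_label) : algC :=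
  if l is Some n then sval (C_prim_root_exists (ltn0Sn (n + n).-1)) else 2.

Definition label_weight s t : algC :=
  label_root (G s t) + (label_root (G s t))^-1.

(* The numbers game, i.e. the contragredient of the geometric representation:
   [label_weight s t] stands for [2 cos (pi / m)]. *)
Definition fire (x : S -> algC) s : S -> algC :=
  fun r => x r + label_weight s r * x s.

Lemma label_root_prim s t n : G s t = Some n ->
  (n + n).-primitive_root (label_root (G s t)).
Proof.
move=> Gst; have := coxeter_m_gt0 G s t; rewrite Gst /label_root.
by case: C_prim_root_exists => z; case: n {Gst}.
Qed.

Lemma label_root_neq0 s t : label_root (G s t) != 0.
Proof.
case Gst: (G s t) => [n|]; last by rewrite /= pnatr_eq0.
have zP := label_root_prim Gst; rewrite -Gst.
have := prim_expr_order zP; apply: contra_eq_neq => ->.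
by rewrite expr0n -leqn0 leqNgt (prim_order_gt0 zP) eq_sym oner_eq0.
Qed.

(** The primitive square root of 1 is -1; hence [fire] negates the fired coordinate without a
    separate case. *)
Lemma label_weight_diag s : label_weight s s = - 2.
Proof.
have Gss : G s s = Some 1%N by apply/coxeter_m_eq1.
have zP := label_root_prim Gss; rewrite /label_weight.
suff -> : label_root (G s s) = -1 by rewrite invrN1 -opprD.
have := prim_expr_order zP; move/eqP; rewrite sqrf_eq1 => /orP[/eqP z1|/eqP //].
by have := prim_order_dvd zP 1; rewrite z1 expr1 eqxx.
Qed.

Lemma label_root_sqr_neq1 s t : s != t -> label_root (G s t) ^+ 2 != 1.
Proof.
move=> st; case Gst: (G s t) => [n|]; last first.
  by rewrite /= -natrX -[1]/(1%:R) eqr_nat.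
have zP := label_root_prim Gst; rewrite -Gst -(prim_order_dvd zP).
apply/negP => d; have n1 : n = 1%N.
  have := dvdn_leq (isT : (0 < 2)%N) d; have := prim_order_gt0 zP; lia.
by rewrite n1 in Gst; move/coxeter_m_eq1/eqP: Gst; apply/negP.
Qed.

Lemma fireK s x : fire (fire x s) s = x.
Proof. by apply/funext => r; rewrite /fire label_weight_diag; ring. Qed.

Definition fire2 s t x := fire (fire x s) t.

(** An eigenfunctional of [fire2 s t]; the hypothesis is symmetric in [z] and [z^-1], which yields a
    second one. *)
Lemma fire2_eigen s t z x : z != 0 -> label_weight s t = z + z^-1 ->
  z * fire2 s t x s + fire2 s t x t = z ^+ 2 * (z * x s + x t).
Proof.
move=> z0 wz; have wz' : label_weight t s = z + z^-1.
  by rewrite -wz /label_weight coxeter_m_sym.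
by rewrite /fire2 /fire !label_weight_diag wz wz'; field.
Qed.

Lemma fire2_iter_eigen s t z n x : z != 0 -> label_weight s t = z + z^-1 ->
  z * iter n (fire2 s t) x s + iter n (fire2 s t) x t =
  z ^+ (n + n) * (z * x s + x t).
Proof.
move=> z0 wz; elim: n => [|n IH]; first by rewrite mul1r.
by rewrite iterS fire2_eigen // IH mulrA -exprD addSn addnS.
Qed.

(* The Gram determinant [4 - w ^+ 2] is nonzero, so every coordinate can be
   corrected by the coordinates [s] and [t] into an invariant. *)
Lemma fire2_invariant s t r : s != t -> exists a b : algC, forall x,
  fire2 s t x r + a * fire2 s t x s + b * fire2 s t x t = x r + a * x s + b * x t.
Proof.
move=> st; set z := label_root (G s t).
have z0 : z != 0 := label_root_neq0 s t.
have d0 : 4 - (z + z^-1) ^+ 2 != 0.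
  have -> : 4 - (z + z^-1) ^+ 2 = - ((z ^+ 2 - 1) / z) ^+ 2 by field.
  rewrite oppr_eq0 expf_neq0 // mulf_neq0 ?invr_eq0 // subr_eq0.
  exact: label_root_sqr_neq1.
have wz : label_weight s t = z + z^-1 by [].
have wz' : label_weight t s = z + z^-1 by rewrite -wz /label_weight coxeter_m_sym.
pose p := label_weight s r; pose q := label_weight t r.
pose w := z + z^-1.
(* Cramer's rule for [2 a - w b = p] and [2 b - w a = q], which express invariance under firing [s]
   and [t]. *)
exists ((2 * p + w * q) / (4 - w ^+ 2)), ((2 * q + w * p) / (4 - w ^+ 2)) => x.
rewrite /fire2 /fire !label_weight_diag wz wz' -/p -/q -/w.
by rewrite -/w in d0; field.
Qed.

(** For [s != t] the two eigenfunctionals are independent and, as [z ^+ (n + n) = 1], both are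
    preserved; this fixes coordinates [s] and [t], and the invariants fix the others. *)
Lemma fire2_iter_id s t n x : G s t = Some n -> iter n (fire2 s t) x = x.
Proof.
move=> Gst; have [st|st] := eqVneq s t.
  move: Gst; rewrite -st (_ : G s s = Some 1%N); last exact/coxeter_m_eq1.
  by move=> [<-] /=; apply: fireK.
set z := label_root (G s t); have z0 : z != 0 := label_root_neq0 s t.
have z1 : z ^+ (n + n) = 1 := prim_expr_order (label_root_prim Gst).
have wz : label_weight s t = z + z^-1 by [].
have wzV : label_weight s t = z^-1 + z^-1^-1 by rewrite invrK addrC.
have e1 := fire2_iter_eigen n x z0 wz.
have e2 : z^-1 * _ + _ = _ := fire2_iter_eigen n x (invr_neq0 z0) wzV.
rewrite z1 mul1r in e1; rewrite exprVn z1 invr1 mul1r in e2.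
set y := iter n _ x in e1 e2 *.
have ys : y s = x s.
  have dz : z - z^-1 != 0.
    have -> : z - z^-1 = (z ^+ 2 - 1) / z by field.
    rewrite mulf_neq0 ?invr_eq0 // subr_eq0; exact: label_root_sqr_neq1.
  apply: (mulfI dz); transitivity ((z * y s + y t) - (z^-1 * y s + y t)).
    by ring.
  by rewrite e1 e2; ring.
have yt : y t = x t by move: e1; rewrite ys => /addrI.
apply/funext => r; have [a [b ab]] := fire2_invariant r st.
have : y r + a * y s + b * y t = x r + a * x s + b * x t.
  rewrite /y; elim: (n) => // k IH; by rewrite iterS ab.
by rewrite ys yt => /addIr/addIr.
Qed.

Lemma label_le_of_alt_eq s t j : s != t -> (0 < j)%N ->
  wp (alt_word s t j) = wp (alt_word t s j) -> label_le (G s t) (Some j).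
Proof.
move=> st j0; rewrite word_prod_alt -[RHS]mul1g => /mulIg.
rewrite -word_prod_flatten -word_prod_nil => eqj.
(* The eigenfunctional is 1 on this vector, so invariance forces the [2j]-th power of the root to be
   1. *)
pose x r : algC := (r == t)%:R.
have xj : iter j (fire2 s t) x = x.
  rewrite -[in LHS]foldl_flatten_nseq; apply: (word_prod_foldl _ _ _ eqj).
    by move=> r y; apply: fireK.
  by move=> ? ? ? y; apply: fire2_iter_id.
have := fire2_iter_eigen j x (label_root_neq0 s t) (erefl _).
rewrite xj /x eqxx (negbTE st) mulr0 add0r mulr1 => /esym/eqP.
case Gst: (G s t) => [n|].
  rewrite -{1}Gst -(prim_order_dvd (label_root_prim Gst)) !addnn -!mul2n.
  by rewrite dvdn_pmul2l // => /dvdn_leq; apply.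
rewrite /= -natrX -[1]/(1%:R) eqr_nat -{2}(expn0 2) eqn_exp2l //; lia.
Qed.

End Geometric.

End Words.

(** * Lifting words from W to W' *)

Section Subgraph.
Variables (S T : finType) (G : coxeter_graph S) (G' : coxeter_graph T).
Variables (f : T -> S) (f_inj : injective f).
Hypothesis subG : forall s t, s != t -> label_le (G' s t) (G (f s) (f t)).

Lemma reduced_word_behead s (u : seq T) :
  reduced_word G' (s :: u) -> reduced_word G' u.
Proof.
move=> /reduced_wordP red; apply/reduced_wordP => v vu.
by have := red (s :: v); rewrite !word_prod_cons vu => /(_ erefl).
Qed.

Lemma alt_word_not_reduced s t m n (b : seq T) :
  G' s t = Some m -> m < n -> ~~ reduced_word G' (alt_word s t n ++ b).
Proof.
move=> Gst mn; apply/negP => /reduced_wordP.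
have := coxeter_m_gt0 G' s t; rewrite Gst; case: m Gst mn => // m Gst mn _.
(* Here [m] is the label minus one. Braiding all but the first of these [m.+2] letters makes two
   equal letters meet and cancel. *)
rewrite -(cat_take_drop m.+2 (alt_word s t n)) take_alt_word // -catA.
set c := drop _ _ ++ b => /(_ (alt_word t s m ++ c)).
have -> : word_prod G' (alt_word s t m.+2 ++ c) = word_prod G' (alt_word t s m ++ c).
  rewrite !word_prod_cat [alt_word s t m.+2]/= -/(alt_word t s m.+1).
  by rewrite word_prod_cons -(word_prod_braid Gst) word_prod_cons coxeter_genKl.
by move/(_ erefl); rewrite !size_cat !size_alt_word; lia.
Qed.

(** Allowing [v] to be shorter than [u] lets one induction prove both Matsumoto's theorem and that
    [u] stays reduced in W. *)
Lemma word_lift (u : seq T) (v : seq S) :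
  reduced_word G' u -> word_prod G v = word_prod G (map f u) -> size v <= size u ->
  exists2 v', v = map f v' & word_prod G' v' = word_prod G' u.
Proof.
have [n] := ubnP (size u); elim: n u v => // n IH [|s u] v.
  by move=> _ _ _; case: v => // _; exists [::].
rewrite ltnS /= => un red vu sv; have redu := reduced_word_behead red.
have vcons : word_prod G v = coxeter_gen G (f s) * word_prod G (map f u).
  by rewrite vu word_prod_cons.
have IHu w : word_prod G w = word_prod G (map f u) -> size w <= size u ->
    size w = size u /\ exists2 w', w = map f w' & word_prod G' w' = word_prod G' u.
  move=> wu sw; have [w' ww' w'u] := IH u w un redu wu sw.
  split; last by exists w'.
  apply/eqP; rewrite eqn_leq sw ww' size_map.
  by move/reduced_wordP: redu; apply.
(* Otherwise an exchange inside [u] gives a word for the tail starting with [f s]; its lift makes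
   [s :: u] non-reduced in W'. *)
have sd w : word_prod G w = word_prod G v -> left_descent G (f s) w.
  rewrite vu => wv; rewrite (left_descent_eq _ wv); apply: contraT.
  move=> /exchange_prefix_cons[i iu si].
  have := word_prod_delete iu si; have := size_delete iu.
  set del := _ ++ _ => sdel del_u.
  have [||_ [[|x w'] //]] := IHu (f s :: del).
  - by rewrite word_prod_cons -del_u coxeter_genKl.
  - by rewrite /= sdel size_map.
  move=> /= [/f_inj <- delw'] w'u; move/reduced_wordP: red => /(_ w').
  rewrite !word_prod_cons -w'u word_prod_cons coxeter_genKl => /(_ erefl).
  by move: sdel; rewrite delw' !size_map /=; lia.
(* Exchanging [f s] into a shorter [w] would give a word for the tail that is shorter than [u]. *)
have minv w : word_prod G w = word_prod G v -> size u < size w.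
  move=> wv; have [i iw si] := exchange_prefix (sd _ wv).
  have := word_prod_delete iw si; have := size_delete iw.
  set del := _ ++ _ => sdel del_w; rewrite ltnNge; apply/negP => wu.
  have [||] := IHu del; last by lia.
    by rewrite -del_w wv vcons coxeter_genKl.
  by lia.
have {sv} sv : size v = (size u).+1 by apply/eqP; rewrite eqn_leq sv minv.
case: v vu sv vcons sd minv => // t v vu sv vcons sd minv.
have [ts|ts] := eqVneq (f s) t.
  have [||_ [v' -> v'u]] := IHu v.
  - by apply: (mulgI (coxeter_gen G (f s))); rewrite -vcons ts word_prod_cons.
  - by move: sv => /= [->].
  by exists (s :: v'); rewrite /= ?ts // !word_prod_cons v'u.
have td : left_descent G t (t :: v).
  apply: contraT => /exchange_prefix_cons[i iv ti].
  have := word_prod_delete iv ti; have := size_delete iv.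
  set del := _ ++ _ => sdel del_v.
  have := minv del; rewrite -del_v word_prod_cons => /(_ erefl).
  by move: sv => /=; lia.
have dih := dihedral_prefix (sd _ erefl) td.
have alt_ne j : 0 < j -> ~~ label_le (G (f s) t) (Some j) ->
    word_prod G (alt_word (f s) t j) <> word_prod G (alt_word t (f s) j).
  by move=> j0 /negP lej e; apply/lej/label_le_of_alt_eq.
case Gst: (G (f s) t) alt_ne => [m|] /= alt_ne; last first.
  (* With an infinite label the alternating prefix could be longer than the whole word [t :: v]. *)
  have [|b _] := dih (size v).+2; last by rewrite /=; lia.
  by move=> j /andP[j0 _]; apply: alt_ne.
have m1 : 1 < m.
  have := coxeter_m_gt0 G (f s) t; have := coxeter_m_eq1 G (f s) t.
  rewrite Gst; case: m {Gst alt_ne} => [|[|m]] // [/(_ erefl)] e.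
  by rewrite e eqxx in ts.
have [|b bv sb] := dih m.
  by move=> j /andP[j0 jm]; apply: alt_ne; rewrite // -ltnNge.
case: m => [//|m] in Gst m1 bv sb alt_ne *.
have [||_ [c' bc c'u]] := IHu (alt_word t (f s) m ++ b).
- by apply: (mulgI (coxeter_gen G (f s))); rewrite -vcons -bv /= word_prod_cons.
- by rewrite size_cat size_alt_word; move: sb sv => /=; lia.
(* From here the label is [m.+1] with [m > 0], so [t] heads the lifted tail and hence is a vertex of
   the subgraph. *)
have [t' tt'] : exists t', t = f t'.
  by case: m m1 c' bc {Gst bv sb alt_ne c'u} => // m _ [//|t' c'] /= [-> _]; exists t'.
have [b' bb' cb'] : exists2 b', b = map f b' & c' = alt_word t' s m ++ b'.
  have mc : m <= size c'.
    by rewrite -(size_map f) -bc size_cat size_alt_word leq_addr.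
  move: bc; rewrite -{1}(cat_take_drop m c') map_cat.
  move/eqP; rewrite eqseq_cat ?size_alt_word ?size_map ?size_takel //
    => /andP[/eqP ac /eqP bc].
  exists (drop m c') => //; rewrite -{1}(cat_take_drop m c'); congr cat.
  by apply: (inj_map f_inj); rewrite -ac map_alt_word tt'.
subst t b c'; rename t' into t; rename b' into b.
have cE : word_prod G' (alt_word s t m.+1 ++ b) = word_prod G' (s :: u).
  by rewrite /= !word_prod_cons c'u.
have red_eq w : word_prod G' w = word_prod G' (s :: u) -> size w = (size u).+1 ->
    reduced_word G' w.
  move=> wu sw; apply/reduced_wordP => x; rewrite wu sw.
  by move/reduced_wordP: red; apply.
have sc : size b + m = size u by move: sb sv; rewrite size_map /=; lia.
have redc : reduced_word G' (alt_word s t m.+1 ++ b).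
  by apply: red_eq => //; rewrite size_cat size_alt_word; lia.
(* A smaller label in [G'] would make the alternating prefix of length [m.+1] non-reduced; so the
   braid move is available in W' as well. *)
have G'st : G' s t = Some m.+1.
  have st : s != t by rewrite -(inj_eq f_inj).
  have := subG st; rewrite Gst; case G'st: (G' s t) => [m'|] //= lem.
  congr Some; apply/eqP; rewrite eqn_leq lem leqNgt; apply/negP => ltm.
  by have := alt_word_not_reduced b G'st ltm; rewrite redc.
have cE' : word_prod G' (t :: (alt_word s t m ++ b)) = word_prod G' (s :: u).
  rewrite -cE -[t :: _]/(alt_word t s m.+1 ++ b).
  by rewrite !word_prod_cat (word_prod_braid G'st).
have redc' : reduced_word G' (alt_word s t m ++ b).
  apply: (reduced_word_behead (s := t)); apply: red_eq => //=.
  by rewrite size_cat size_alt_word; lia.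
(* After the braid move both words start with [t], so induction applies to their tails. *)
have [||| v' -> v'c] := IH (alt_word s t m ++ b) v _ redc'.
- by rewrite size_cat size_alt_word; lia.
- apply: (mulgI (coxeter_gen G (f t))); rewrite -!word_prod_cons -bv.
  rewrite -[f t :: _]/(map f (t :: alt_word s t m ++ b)).
  rewrite -[t :: _]/(alt_word t s m.+1 ++ b) map_cat map_alt_word.
  by rewrite !word_prod_cat (word_prod_braid Gst).
- by rewrite size_cat size_alt_word; move: sv => /=; lia.
exists (t :: v') => //.
by rewrite word_prod_cons v'c -word_prod_cons.
Qed.

End Subgraph.

(** * Injectivity on minimal words, and infinitude *)

Theorem proposition5p4 (S : finType) (G : coxeter_graph S)
    (S' : {set S}) (G' : coxeter_graph {x : S | x \in S'})
    (le : rel {x : S | x \in S'}) :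
  coxeter_subgraph G G' ->
  total_order le ->
  injective (fun w : coxeter_group G' =>
    word_prod G [seq val s | s <- min_word le w]) /\
  (infinite_set [set: coxeter_group G'] ->
   infinite_set [set: coxeter_group G]).
Proof.
move=> subG tot.
pose f (w : coxeter_group G') := word_prod G [seq val s | s <- min_word le w].
have injf : injective f.
  move=> w1 w2; rewrite /f.
  have [u1 r1 _] := min_wordP w1 tot; have [u2 r2 _] := min_wordP w2 tot.
  (* The longer word serves as the reduced word to which the other one is compared. *)
  wlog le12 : w1 w2 u1 r1 u2 r2 / size (min_word le w1) <= size (min_word le w2).
    move=> H e; case: (leqP (size (min_word le w1)) (size (min_word le w2))).
      by move/H; apply.
    by move/ltnW/H => e'; apply/esym/e'.
  move=> e; have [|v ev vu] := word_lift val_inj subG r2 e.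
    by rewrite size_map.
  by rewrite -u1 -u2 -vu; congr word_prod; apply: (inj_map val_inj).
split=> // inf fin; apply: inf.
have := finite_preimage (f := f) (B := [set: coxeter_group G]).
by rewrite preimage_setT; apply=> // ? ? _ _; apply: injf.
Qed.
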